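(* Let $n\ge 2$. (1) If $n$ is odd, $X_{C_n}(\mathbf{x},t)$ is $e$-unimodal and palindromic with center of symmetry $\frac n2$. (2) If $n$ is even, then (a) $X_{C_n}(\mathbf{x},t)$ is $e$-positive and palindromic with center of symmetry $\frac n2$, but is not $e$-unimodal; (b) $X_{C_n}(\mathbf{x},t)+t^{n/2}e_{2^{n/2}}(\mathbf{x})$ is $e$-unimodal and palindromic with center of symmetry $\frac n2$.
   Context: For a graph $G$ on vertex set $\{1,\dots,n\}$ with edge set $E$, the chromatic quasisymmetric function is $X_G(\mathbf{x},t):=\sum_{\kappa} t^{\mathrm{des}(\kappa)}x_{\kappa(1)}\cdots x_{\kappa(n)}$, summed over all proper colorings $\kappa:\{1,\dots,n\}\to\{1,2,3,\dots\}$ of $G$, where $\mathrm{des}(\kappa)$ is the number of edges $\{i,j\}\in E$ with $i<j$ and $\kappa(i)>\kappa(j)$. $C_n$ is the labeled cycle on $\{1,\dots,n\}$ with edges $\{i,i+1\}$ for $1\le i\le n-1$ together with the edge $\{1,n\}$. For $n=2$ the edge $\{1,2\}$ is counted twice (double edge), so $X_{C_2}(\mathbf{x},t)=(1+t^2)e_2(\mathbf{x})$. Equivalently, for all $n\ge 2$, $X_{C_n}(\mathbf{x},t)=\sum t^{\mathrm{des}(w)}x_w+t\sum t^{\mathrm{des}(w)}x_w$, where both sums are over words $w=w_1\cdots w_n$ of positive integers with no two adjacent letters equal, the first with $w_1<w_n$ and the second with $w_1>w_n$; here $x_w=x_{w_1}\cdots x_{w_n}$ and $\mathrm{des}(w)=|\{i\in\{1,\dots,n-1\}:w_i>w_{i+1}\}|$.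 $e_\lambda$ denotes the elementary symmetric function indexed by the partition $\lambda$, and $2^m$ is the partition with $m$ parts all equal to $2$, so $e_{2^m}=e_2^m$. For symmetric functions $r,s$ over $\mathbb{Q}$ write $r\le_e s$ if $s-r$ has nonnegative coefficients in the elementary symmetric function basis. A polynomial $a_0+a_1t+\cdots+a_mt^m$ whose coefficients are symmetric functions is $e$-positive if $0\le_e a_j$ for all $j$; it is $e$-unimodal if $0\le_e a_0\le_e\cdots\le_e a_c\ge_e a_{c+1}\ge_e\cdots\ge_e a_m\ge_e 0$ for some $c$; it is palindromic with center of symmetry $\frac m2$ if $a_j=a_{m-j}$ for $0\le j\le m$ ($a_m$ is allowed to be zero). *)

(* Defs.v *)
From HB Require Import structures.
From mathcomp Require Import all_boot all_order all_algebra.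
From mathcomp Require Import finmap multiset boolp zify.

Set Implicit Arguments.
Unset Strict Implicit.
Unset Printing Implicit Defensive.

Import GRing.Theory.
Local Open Scope mset_scope.
Local Open Scope ring_scope.

(** Monomials are finite multisets of variables, and [f m] is the coefficient
    of the product of the variables in [m]. The variable of index [c : nat] is
    x_(c+1): colors, like vertices below, are numbered from 0. *)
Definition fps : Type := {mset nat} -> rat.

(** The divisors of the monomial [m]; see [mem_submsets]. *)
Definition submsets (m : {mset nat}) : {fset {mset nat}} :=
  [fset seq_mset (mask b m) | b : (size m).-tuple bool in predT]%fset.

Definition fps_mul (f g : fps) : fps := fun m =>
  \sum_(a <- submsets m) \sum_(b <- submsets m | a `+` b == m) f a * g b.

Lemma fpsP (f g : fps) : f =1 g <-> f = g.
Proof. by split=> [/funext|->]. Qed.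

Lemma submask_perm (s t : seq nat) :
    (forall x, count_mem x s <= count_mem x t)%N ->
  exists w, size w = size t /\ perm_eq (mask w t) s.
Proof.
elim: t s => [|y t IH] s st.
  exists [::]; split => //=; suff -> : s = [::] by [].
  by case: s st => // z s /(_ z); rewrite /= eqxx.
have [ys|yNs] := boolP (y \in s).
  have [|w [sw pw]] := IH (rem y s).
    move=> x; have := st x; rewrite (permP (perm_to_rem ys)) /=; lia.
  exists (true :: w); split; first by rewrite /= sw.
  by rewrite perm_sym (perm_trans (perm_to_rem ys)) //= perm_cons perm_sym.
have [|w [sw pw]] := IH s; last by exists (false :: w); rewrite /= sw.
move=> x; have := st x; rewrite /=; case: eqVneq => // <-.
by rewrite (count_memPn yNs).
Qed.

Lemma mem_submsets (m a : {mset nat}) : (a \in submsets m) = (a `<=` m).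
Proof.
apply/imfsetP/msubsetP => [[b _ ->] x | am].
  by rewrite mset_seqE -[leqRHS]count_mem_mset leq_count_subseq // mask_subseq.
have [|w [/eqP sz_w pw]] := @submask_perm a m.
  by move=> x; rewrite !count_mem_mset.
exists (Tuple sz_w) => //=; rewrite -[LHS]seq_mset_id.
by apply/eq_seq_msetP; rewrite perm_sym.
Qed.

Lemma fps_mulE (S : seq {mset nat}) (f g : fps) m : uniq S ->
    {subset submsets m <= S} ->
  fps_mul f g m = \sum_(a <- S) \sum_(b <- S | a `+` b == m) f a * g b.
Proof.
move=> uS sS.
have H (F : {mset nat} -> rat) : (forall a, ~~ (a `<=` m) -> F a = 0) ->
    \sum_(a <- submsets m) F a = \sum_(a <- S) F a.
  move=> F0; rewrite [RHS](bigID (fun a => a \in submsets m)) /= [X in _ + X]big1 ?addr0.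
    rewrite -[RHS]big_filter; apply: perm_big; apply: uniq_perm => //.
    - exact: fset_uniq.
    - by rewrite filter_uniq.
    move=> x; rewrite mem_filter.
    by case: (boolP (x \in submsets m)) => // /sS ->.
  by move=> a; rewrite mem_submsets; apply: F0.
rewrite /fps_mul H; last first.
  move=> a aNm; apply: big1 => b /eqP E.
  case/negP: aNm; apply/msubsetP => x; rewrite -E msetE2; lia.
apply: eq_bigr => a _; rewrite big_mkcond [RHS]big_mkcond; apply: H => b bNm.
case: eqP => // E; case/negP: bNm; apply/msubsetP => x; rewrite -E msetE2; lia.
Qed.

Lemma fps_mulC : commutative fps_mul.
Proof.
move=> f g; apply/fpsP => m; rewrite /fps_mul (exchange_big_dep predT) //=.
by apply: eq_bigr => a _; apply: eq_big => [b|b _]; rewrite (msetDC, mulrC).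
Qed.

Lemma fps_mul3E (f g h : fps) m (S := submsets m : seq {mset nat}) :
  fps_mul (fps_mul f g) h m =
  \sum_(a <- S) \sum_(b <- S) \sum_(c <- S)
    if a `+` b `+` c == m then f a * g b * h c else 0.
Proof.
have uS : uniq S by exact: fset_uniq.
transitivity (\sum_(d <- S) \sum_(a <- S) \sum_(b <- S) \sum_(c <- S)
   if (a `+` b == d) && (d `+` c == m) then f a * g b * h c else 0).
  apply: eq_big_seq => d; rewrite mem_submsets => dm.
  rewrite (@fps_mulE S) //; last first.
    by move=> a; rewrite !mem_submsets => /msubset_trans; apply.
  under [RHS]eq_bigr do rewrite exchange_big /=.
  rewrite exchange_big /= big_mkcond; apply: eq_bigr => c _.
  case: ifP => [dc|dc]; last first.
    by rewrite big1 // => a _; rewrite big1 // => b _; rewrite andbF.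
  rewrite mulr_suml; apply: eq_bigr => a _; rewrite big_mkcond mulr_suml.
  by apply: eq_bigr => b _; rewrite andbT; case: ifP => _; rewrite ?mul0r.
rewrite exchange_big; apply: eq_bigr => a _ /=.
rewrite exchange_big; apply: eq_bigr => b _ /=.
rewrite exchange_big; apply: eq_bigr => c _ /=.
have [E|abcN] := eqVneq (a `+` b `+` c) m.
  rewrite (bigD1_seq (a `+` b)) //=.
    rewrite E !eqxx big1 ?addr0 // => d dN.
    by rewrite eq_sym (negPf dN).
  by rewrite mem_submsets -E; apply/msubsetP => x; rewrite [leqRHS]msetE2 leq_addr.
by apply: big1 => d _; case: eqP => // <-; rewrite (negPf abcN).
Qed.

Lemma fps_mulA : associative fps_mul.
Proof.
move=> f g h; rewrite fps_mulC; apply/fpsP => m; rewrite !fps_mul3E.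
transitivity (\sum_(b <- submsets m) \sum_(a <- submsets m)
   \sum_(c <- submsets m) if a `+` b `+` c == m then f a * g b * h c else 0).
  apply: eq_bigr => b _; rewrite exchange_big; apply: eq_bigr => a _.
  apply: eq_bigr => c _.
  by rewrite (msetDC _ a) msetDA mulrC mulrA.
by rewrite exchange_big.
Qed.

Definition fps_zero : fps := fun=> 0.
Definition fps_opp (f : fps) : fps := fun m => - f m.
Definition fps_add (f g : fps) : fps := fun m => f m + g m.
Definition fps_one : fps := fun m => (m == mset0)%:R.
Definition fps_scale (c : rat) (f : fps) : fps := fun m => c * f m.

HB.instance Definition _ := gen_eqMixin fps.
HB.instance Definition _ := gen_choiceMixin fps.

Fact fps_addA : associative fps_add.
Proof. by move=> f g h; apply/fpsP => m; rewrite /fps_add addrA. Qed.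
Fact fps_addC : commutative fps_add.
Proof. by move=> f g; apply/fpsP => m; rewrite /fps_add addrC. Qed.
Fact fps_add0 : left_id fps_zero fps_add.
Proof. by move=> f; apply/fpsP => m; rewrite /fps_add add0r. Qed.
Fact fps_addN : left_inverse fps_zero fps_opp fps_add.
Proof. by move=> f; apply/fpsP => m; rewrite /fps_add addNr. Qed.

HB.instance Definition _ :=
  GRing.isZmodule.Build fps fps_addA fps_addC fps_add0 fps_addN.

Fact fps_mul1 : left_id fps_one fps_mul.
Proof.
move=> f; apply/fpsP => m; rewrite /fps_mul (bigD1_seq mset0) ?fset_uniq //=; last first.
  by rewrite mem_submsets msub0set.
rewrite [X in _ + X]big1 => [|a aN0]; last first.
  by apply: big1 => b _; rewrite /fps_one (negPf aN0) mul0r.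
rewrite addr0 big_mkcond (bigD1_seq m) ?fset_uniq //=; last first.
  by rewrite mem_submsets msubset_refl.
rewrite /fps_one mset0D !eqxx mul1r big1 ?addr0 // => b bNm.
by rewrite mset0D (negPf bNm).
Qed.

Fact fps_mulDl : left_distributive fps_mul fps_add.
Proof.
move=> f g h; apply/fpsP => m; rewrite /fps_mul /fps_add -big_split /=.
apply: eq_bigr => a _; rewrite -big_split /=.
by apply: eq_bigr => b _; rewrite mulrDl.
Qed.

Fact fps_one_neq0 : fps_one != 0.
Proof. by apply/eqP => /fpsP/(_ mset0); rewrite /fps_one eqxx. Qed.

HB.instance Definition _ := GRing.Zmodule_isComNzRing.Build fps
  fps_mulA fps_mulC fps_mul1 fps_mulDl fps_one_neq0.

Fact fps_scaleA a b f : fps_scale a (fps_scale b f) = fps_scale (a * b) f.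
Proof. by apply/fpsP => m; rewrite /fps_scale mulrA. Qed.
Fact fps_scale1 : left_id 1 fps_scale.
Proof. by move=> f; apply/fpsP => m; rewrite /fps_scale mul1r. Qed.
Fact fps_scaleDr : right_distributive fps_scale +%R.
Proof. by move=> a f g; apply/fpsP => m; exact: mulrDr. Qed.
Fact fps_scaleDl f : {morph fps_scale^~ f : a b / a + b}.
Proof. by move=> a b; apply/fpsP => m; exact: mulrDl. Qed.

HB.instance Definition _ := GRing.Zmodule_isLmodule.Build rat fps
  fps_scaleA fps_scale1 fps_scaleDr fps_scaleDl.

Fact fps_scaleAl (c : rat) (f g : fps) : c *: (f * g) = (c *: f) * g.
Proof.
apply/fpsP => m; rewrite [LHS]mulr_sumr; apply: eq_bigr => a _.
by rewrite mulr_sumr; apply: eq_bigr => b _; rewrite mulrA.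
Qed.

HB.instance Definition _ := GRing.Lmodule_isLalgebra.Build rat fps fps_scaleAl.

Definition elem_sym (k : nat) : fps := fun m => ((size m == k) && uniq m)%:R.

Record intpart := IntPart {
  parts :> seq nat;
  _ : sorted geq parts && (0%N \notin parts) }.
HB.instance Definition _ := [isSub for parts].
HB.instance Definition _ := [Countable of intpart by <:].

Definition elem_sym_part (s : seq nat) : fps := \prod_(k <- s) elem_sym k.

(** The family [c] lists the coefficients of [s - r] in the basis of the
    [e_lambda]. *)
Definition e_le (r s : fps) : Prop :=
  exists c : {fsfun intpart -> rat with 0},
    (forall l, 0 <= c l) /\
    s - r = \sum_(l <- finsupp c) c l *: elem_sym_part l.

Definition e_positive (P : {poly fps}) : Prop := forall j, e_le 0 P`_j.

(** [P] is viewed as [a_0 + ... + a_m t^m], where [a_m] may be zero. *)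
Definition e_unimodal (P : {poly fps}) : Prop :=
  exists m c : nat,
    [/\ (size P <= m.+1)%N /\ (c <= m)%N,
        e_le 0 P`_0,
        forall j, (j < c)%N -> e_le P`_j P`_j.+1,
        forall j, (c <= j < m)%N -> e_le P`_j.+1 P`_j
      & e_le 0 P`_m].

(** Symmetry about [m / 2]. *)
Definition palindromic (m : nat) (P : {poly fps}) : Prop :=
  (size P <= m.+1)%N /\ forall j, (j <= m)%N -> P`_j = P`_(m - j).

Section Chromatic.
Variable n : nat.

(** A multigraph is given by the list of its edges [(i, j)] with [i < j], so
    that a double edge occurs twice in the list. *)
Implicit Types (E : seq ('I_n * 'I_n)) (k : 'I_n -> nat).

Definition proper E k : bool := all (fun e => k e.1 != k e.2) E.

Definition des E k : nat :=
  count (fun e : 'I_n * 'I_n => (e.1 < e.2)%N && (k e.2 < k e.1)%N) E.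

Definition xmon k : {mset nat} := seq_mset [seq k i | i <- enum 'I_n].

(** A coloring whose monomial is [m] takes its values in [finsupp m], so the
    coefficient of [m] in the infinite sum over all proper colorings is a
    finite count; [des] is at most the number of edges. *)
Definition chromatic_qsym E : {poly fps} :=
  \poly_(j < (size E).+1) ((fun m : {mset nat} =>
    #|[set k : {ffun 'I_n -> finsupp m} |
        let k' := fun i => val (k i) in
        [&& proper E k', xmon k' == m & des E k' == j]]|%:R) : fps).

(** The edges of the cycle; [n = 2] yields the edge [(0, 1)] twice. *)
Definition cycle_edges : seq ('I_n * 'I_n) :=
  [seq e <- enum {: 'I_n * 'I_n} | val e.2 == (val e.1).+1] ++
  [seq e <- enum {: 'I_n * 'I_n} | (val e.1 == 0%N) && (val e.2 == n.-1)].

End Chromatic.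

(* Main.v *)
(** Fix finitely many variables and put [E(z) = prod_b (1 + x_b z)]. Among the
    proper words with last letter [c], let [S_a(z)] count those with first
    letter [a]. The sums [T_a = sum_(b >= a) S_b + t sum_(b < a) S_b] satisfy
      [(1 + x_a z) T_(a+1) = (1 + t x_a z) T_a + (t - 1) x_a z [a = c]],
    a recursion with boundary condition [T_oo = t T_0]. Solving it and summing
    over [c] (the mixed terms telescope) gives
      [(t E(z) - E(tz)) sum_n X_(C_n) z^n
         = z E'(tz) - t^2 z E'(z) + (t + 1) (E(tz) - E(z))],
    that is, with [[k] = 1 + t + ... + t^(k-1)],
      [X_(C_n) = c_n e_n + sum_(2 <= k <= n-2) t [k-1] e_k X_(C_(n-k))],
    where [c_2 = 1 + t^2] and [c_n = (1 + t) [n] + n t^2 [n-3]] for [n >= 3].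
    Unrolling the recursion writes the coefficient of [e_lambda] as a sum of
    products of palindromic unimodal polynomials, except for the term
    [(1 + t^2) t^(n/2-1)] at [lambda = 2^(n/2)] when [n] is even. In two
    variables only this exceptional term survives; as the coefficient of a fixed
    monomial is nonnegative on every [e_lambda], it obstructs unimodality. *)

From HB Require Import structures.
From mathcomp Require Import all_boot all_order all_algebra.
From mathcomp Require Import finmap multiset boolp zify ring.
Require Import Defs.
Import Order.TTheory GRing.Theory Num.Theory.
Local Open Scope ring_scope.

Set Implicit Arguments.
Unset Strict Implicit.
Unset Printing Implicit Defensive.

(** * The transfer equation for words *)

Lemma sum_nat_split3 (V : nmodType) (F : nat -> V) (c n : nat) : (c < n)%N ->
  \sum_(0 <= b < n) F b =
  \sum_(0 <= b < c) F b + F c + \sum_(c.+1 <= b < n) F b.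
Proof.
move=> cn; rewrite (big_cat_nat (n := c)) //= 1?ltnW // (big_ltn cn).
by rewrite addrA.
Qed.

Section Transfer.
Variables (K : comNzRingType) (y : nat -> K) (t : K) (N : nat).

(** Read [y b = x_b z]: these are the factors of [E(z)] and [E(tz)] coming from
    the letters in the interval from [i] to [j - 1]. *)
Definition prodA (i j : nat) : K := \prod_(i <= b < j) (1 + y b).
Definition prodB (i j : nat) : K := \prod_(i <= b < j) (1 + t * y b).

Lemma lreg_prod_nat (f : nat -> K) (i j : nat) :
  (forall b, GRing.lreg (f b)) -> GRing.lreg (\prod_(i <= b < j) f b).
Proof.
by move=> f_reg; elim/big_ind: _ => //; [exact: lreg1 | exact: lregM].
Qed.

Hypothesis regA : forall b, GRing.lreg (1 + y b).
Hypothesis regB : forall b, GRing.lreg (1 + t * y b).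
Hypothesis regt : GRing.lreg (t - 1).

Section FixedEnd.
Variables (c : nat) (S : nat -> K).
Hypothesis ltcN : (c < N)%N.
Hypothesis transfer : forall a, (a < N)%N ->
  S a = y a * ((a == c)%:R + \sum_(a.+1 <= b < N) S b
                           + t * \sum_(0 <= b < a) S b).

Let T a := \sum_(a <= b < N) S b + t * \sum_(0 <= b < a) S b.

(** Passing from [T a] to [T a.+1] moves the letter [a] from weight 1 to weight [t]; the transfer
    equation eliminates [S a] from the change. *)
Lemma transfer_step a : (a < N)%N ->
  (1 + y a) * T a.+1 = (1 + t * y a) * T a + (t - 1) * y a * (a == c)%:R.
Proof.
move=> aN; rewrite /T big_nat_recr //= (big_ltn aN).
have := transfer aN; set U := \sum_(_ <= b < N) _; set L := \sum_(_ <= b < a) _.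
set s := S a => E.
apply/eqP; rewrite -subr_eq0; apply/eqP.
(* The two sides differ by [t - 1] times the defect of the transfer equation at [a]. *)
transitivity ((t - 1) * (s - y a * ((a == c)%:R + U + t * L))); first by ring.
by rewrite -E subrr mulr0.
Qed.

Lemma transfer_low a : (a <= c)%N -> prodA 0 a * T a = prodB 0 a * T 0.
Proof.
elim: a => [|a IH] ac; first by rewrite /prodA /prodB !big_geq.
rewrite /prodA /prodB !big_nat_recr //= -!mulrA.
rewrite transfer_step ?(ltn_trans ac) // (ltn_eqF ac) mulr0 addr0.
by rewrite mulrCA -/(prodA 0 a) IH ?(ltnW ac) // mulrCA.
Qed.

(** Above [c] the step is homogeneous again, and is iterated downwards from [N]. *)
Lemma transfer_high a : (c < a <= N)%N -> prodA a N * T N = prodB a N * T a.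
Proof.
move=> /andP[ca aN]; move: ca.
have [d -> ] : exists d, a = (N - d)%N by exists (N - a)%N; rewrite subKn.
elim: d => [|d IH] ca; first by rewrite subn0 /prodA /prodB !big_geq.
(* For [d >= N] truncated subtraction makes the claim at [d.+1] the claim at [d]. *)
have [dN|Nd] := ltnP d N; last first.
  have -> : (N - d.+1 = N - d)%N by lia.
  by apply: IH; lia.
have E : (N - d = (N - d.+1).+1)%N by lia.
have lt1 : (N - d.+1 < N)%N by lia.
rewrite /prodA /prodB !(big_ltn lt1) -E -!mulrA.
rewrite -/(prodA (N - d) N) -/(prodB (N - d) N) IH; last by lia.
have /= := transfer_step lt1; rewrite (gtn_eqF ca) mulr0 addr0 -E => step.
by rewrite mulrCA step mulrCA.
Qed.

Lemma transfer_total : T N = t * T 0.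
Proof. by rewrite /T !(big_geq (leqnn _)) mulr0 addr0 add0r. Qed.

(** The low relation, the step at [c], the high relation and [T N = t * T 0] close up to a loop,
    which determines [T 0], [T c] and [T c.+1] after multiplication by [t * prodA 0 N - prodB 0 N].
    Nothing is divided; regular factors are cancelled. *)
Lemma cycle_fixed_end :
  (t * prodA 0 N - prodB 0 N) *
    (\sum_(0 <= a < c) S a + t * \sum_(c.+1 <= a < N) S a)
  = y c * (prodB 0 c * prodB c.+1 N
     + (t ^+ 2 - 1) * (prodA 0 c * prodB c.+1 N)
     - t ^+ 2 * (prodA 0 c * prodA c.+1 N)).
Proof.
have eA : prodA 0 N = prodA 0 c * (1 + y c) * prodA c.+1 N.
  by rewrite /prodA (big_cat_nat (n := c)) //= 1?ltnW // (big_ltn ltcN) mulrA.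
have eB : prodB 0 N = prodB 0 c * (1 + t * y c) * prodB c.+1 N.
  by rewrite /prodB (big_cat_nat (n := c)) //= 1?ltnW // (big_ltn ltcN) mulrA.
have Ec := transfer_step ltcN; rewrite eqxx mulr1 in Ec.
have El := transfer_low (leqnn c).
have Eh : prodA c.+1 N * (t * T 0) = prodB c.+1 N * T c.+1.
  by rewrite -transfer_total; apply: transfer_high; rewrite ltnSn.
(* Going once around the loop returns [t * T 0]; what remains is the inhomogeneous term at [c]. *)
have main : (t * prodA 0 N - prodB 0 N) * T 0
    = (t - 1) * y c * (prodA 0 c * prodB c.+1 N).
  rewrite mulrBl eA.
  transitivity (prodA 0 c * (1 + y c) * (prodA c.+1 N * (t * T 0)) - prodB 0 N * T 0).
    by ring.
  rewrite Eh.
  transitivity (prodA 0 c * prodB c.+1 N * ((1 + y c) * T c.+1) - prodB 0 N * T 0).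
    by ring.
  rewrite Ec eB.
  transitivity ((1 + t * y c) * prodB c.+1 N * (prodA 0 c * T c)
    - prodB 0 c * (1 + t * y c) * prodB c.+1 N * T 0
    + (t - 1) * y c * (prodA 0 c * prodB c.+1 N)); first by ring.
  by rewrite El; ring.
have low : (t * prodA 0 N - prodB 0 N) * T c
    = (t - 1) * y c * (prodB 0 c * prodB c.+1 N).
  apply: (@lreg_prod_nat (fun b => 1 + y b) 0 c regA); rewrite -/(prodA 0 c).
  by rewrite mulrCA El mulrCA main; ring.
have high : (t * prodA 0 N - prodB 0 N) * T c.+1
    = t * (t - 1) * y c * (prodA 0 c * prodA c.+1 N).
  apply: (@lreg_prod_nat (fun b => 1 + t * y b) c.+1 N regB).
  rewrite -/(prodB c.+1 N) mulrCA -Eh.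
  transitivity (t * prodA c.+1 N * ((t * prodA 0 N - prodB 0 N) * T 0)); first by ring.
  by rewrite main; ring.
apply: regt; rewrite mulrCA.
(* The wanted sum, times [t - 1], is a combination of the three values already solved for. *)
have -> : (t - 1) * (\sum_(0 <= a < c) S a + t * \sum_(c.+1 <= a < N) S a)
   = T c - T 0 + t ^+ 2 * T 0 - t * T c.+1.
  rewrite /T (big_geq (leqnn 0)) (sum_nat_split3 _ ltcN) (big_ltn ltcN) big_nat_recr //=.
  by ring.
transitivity ((t * prodA 0 N - prodB 0 N) * T c
  + (t ^+ 2 - 1) * ((t * prodA 0 N - prodB 0 N) * T 0)
  - t * ((t * prodA 0 N - prodB 0 N) * T c.+1)); first by ring.
by rewrite main low high; ring.
Qed.

End FixedEnd.

(** Since [(t - 1) * y c] is the difference of the factors [1 + t * y c] and [1 + y c], each summand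
    is a difference of neighbouring hybrid products: factors of [prodA] up to some letter, factors
    of [prodB] after it. *)
Lemma prodAB_telescope :
  (t - 1) * \sum_(0 <= c < N) y c * (prodA 0 c * prodB c.+1 N)
  = prodB 0 N - prodA 0 N.
Proof.
have -> : prodB 0 N - prodA 0 N = - \sum_(0 <= c < N)
    (prodA 0 c.+1 * prodB c.+1 N - prodA 0 c * prodB c N).
  rewrite telescope_sumr // /prodA /prodB !(big_geq (leqnn _)).
  by ring.
rewrite -sumrN mulr_sumr !big_nat; apply: eq_bigr => c /andP[_ cN].
by rewrite /prodA /prodB big_nat_recr //= (big_ltn cN); ring.
Qed.

Lemma cycle_transfer (S : nat -> nat -> K) :
  (forall a c, (a < N)%N -> (c < N)%N ->
     S a c = y a * ((a == c)%:R + \sum_(a.+1 <= b < N) S b c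
                           + t * \sum_(0 <= b < a) S b c)) ->
  (t * prodA 0 N - prodB 0 N) *
    \sum_(0 <= c < N)
       (\sum_(0 <= a < c) S a c + t * \sum_(c.+1 <= a < N) S a c)
  = \sum_(0 <= c < N) y c * (prodB 0 c * prodB c.+1 N)
    - t ^+ 2 * \sum_(0 <= c < N) y c * (prodA 0 c * prodA c.+1 N)
    + (t + 1) * (prodB 0 N - prodA 0 N).
Proof.
move=> transfer.
transitivity (\sum_(0 <= c < N) (y c * (prodB 0 c * prodB c.+1 N)
   - t ^+ 2 * (y c * (prodA 0 c * prodA c.+1 N))
   + (t + 1) * ((t - 1) * (y c * (prodA 0 c * prodB c.+1 N))))).
  rewrite mulr_sumr !big_nat; apply: eq_bigr => c /andP[_ cN].
  rewrite (cycle_fixed_end cN (S := S^~ c)); first by ring.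
  by move=> a aN; apply: transfer.
by rewrite big_split sumrB /= -!mulr_sumr prodAB_telescope.
Qed.

End Transfer.

(** * Power series and the recursion *)

Definition pser (R : Type) : Type := nat -> R.

Section PowerSeries.
Variable R : comNzRingType.
Implicit Types (f g h : pser R) (p q : {poly R}).

Lemma pserP f g : f =1 g -> f = g.
Proof. exact: funext. Qed.

Definition pser_zero : pser R := fun=> 0.
Definition pser_opp f : pser R := fun n => - f n.
Definition pser_add f g : pser R := fun n => f n + g n.
Definition pser_one : pser R := fun n => (n == 0%N)%:R.
Definition pser_mul f g : pser R := fun n => \sum_(i < n.+1) f i * g (n - i)%N.

HB.instance Definition _ := gen_eqMixin (pser R).
HB.instance Definition _ := gen_choiceMixin (pser R).

Fact pser_addA : associative pser_add.
Proof. by move=> f g h; apply: pserP => n; rewrite /pser_add addrA. Qed.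
Fact pser_addC : commutative pser_add.
Proof. by move=> f g; apply: pserP => n; rewrite /pser_add addrC. Qed.
Fact pser_add0 : left_id pser_zero pser_add.
Proof. by move=> f; apply: pserP => n; rewrite /pser_add add0r. Qed.
Fact pser_addN : left_inverse pser_zero pser_opp pser_add.
Proof. by move=> f; apply: pserP => n; rewrite /pser_add addNr. Qed.

HB.instance Definition _ :=
  GRing.isZmodule.Build (pser R) pser_addA pser_addC pser_add0 pser_addN.

Definition truncate n f : {poly R} := \poly_(i < n) f i.

(** A coefficient of a product depends only on coefficients up to the same index, so the ring laws
    are inherited from polynomials. *)
Lemma pser_mul_truncate n k f g : (k < n)%N ->
  pser_mul f g k = (truncate n f * truncate n g)`_k.
Proof.
move=> kn; rewrite coefM; apply: eq_bigr => i _; rewrite !coef_poly.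
have ik : (i <= k)%N by rewrite -ltnS.
by rewrite (leq_ltn_trans ik kn) (leq_ltn_trans (leq_subr _ _) kn).
Qed.

Lemma coefM_eq n p p' q q' :
  (forall k, (k <= n)%N -> p`_k = p'`_k) ->
  (forall k, (k <= n)%N -> q`_k = q'`_k) -> (p * q)`_n = (p' * q')`_n.
Proof.
move=> pp' qq'; rewrite !coefM; apply: eq_bigr => i _.
by rewrite pp' ?qq' ?leq_subr // -ltnS.
Qed.

Lemma coef_truncate_mul n k f g : (k < n)%N ->
  (truncate n (pser_mul f g))`_k = (truncate n f * truncate n g)`_k.
Proof. by move=> kn; rewrite coef_poly kn (pser_mul_truncate _ _ kn). Qed.

Fact pser_mulC : commutative pser_mul.
Proof.
by move=> f g; apply: pserP => n; rewrite !(pser_mul_truncate _ _ (ltnSn n)) mulrC.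
Qed.

Fact pser_mulA : associative pser_mul.
Proof.
move=> f g h; apply: pserP => n; rewrite !(pser_mul_truncate _ _ (ltnSn n)).
transitivity ((truncate n.+1 f * (truncate n.+1 g * truncate n.+1 h))`_n).
  by apply: coefM_eq => // k kn; rewrite coef_truncate_mul.
by rewrite mulrA; apply: coefM_eq => // k kn; rewrite coef_truncate_mul.
Qed.

Fact pser_mul1 : left_id pser_one pser_mul.
Proof.
move=> f; apply: pserP => n; rewrite /pser_mul big_ord_recl subn0 mul1r.
by rewrite big1 ?addr0 // => i _; rewrite mul0r.
Qed.

Fact pser_mulDl : left_distributive pser_mul pser_add.
Proof.
move=> f g h; apply: pserP => n; rewrite /pser_mul /pser_add -big_split.
by apply: eq_bigr => i _; rewrite mulrDl.
Qed.

Fact pser_one_neq0 : pser_one != 0.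
Proof.
by apply/eqP => /(congr1 (@^~ 0%N)) /eqP; rewrite (negPf (oner_neq0 R)).
Qed.

HB.instance Definition _ := GRing.Zmodule_isComNzRing.Build (pser R)
  pser_mulA pser_mulC pser_mul1 pser_mulDl pser_one_neq0.

Definition pser_of_poly p : pser R := fun n => p`_n.

Fact pser_of_poly_additive : additive pser_of_poly.
Proof. by move=> p q; apply: pserP => n; rewrite /pser_of_poly coefB. Qed.
Fact pser_of_poly_multiplicative : monoid_morphism pser_of_poly.
Proof.
split; first by apply: pserP => n; rewrite /pser_of_poly coef1.
by move=> p q; apply: pserP => n; rewrite /pser_of_poly coefM.
Qed.

HB.instance Definition _ := GRing.isZmodMorphism.Build {poly R} (pser R)
  pser_of_poly pser_of_poly_additive.
HB.instance Definition _ := GRing.isMonoidMorphism.Build {poly R} (pser R)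
  pser_of_poly pser_of_poly_multiplicative.

Lemma pserME f g n : (f * g) n = \sum_(i < n.+1) f i * g (n - i)%N.
Proof. by []. Qed.

Lemma pserDE f g n : (f + g) n = f n + g n.
Proof. by []. Qed.

Lemma pser_sumE I (r : seq I) (P : pred I) (F : I -> pser R) n :
  (\sum_(i <- r | P i) F i) n = \sum_(i <- r | P i) F i n.
Proof. by elim/big_rec2: _ => // i f x _ <-. Qed.

Lemma pser_polyCM (c : R) f n : (pser_of_poly c%:P * f) n = c * f n.
Proof.
rewrite pserME big_ord_recl subn0 {1}/pser_of_poly coefC big1 ?addr0 // => i _.
by rewrite /pser_of_poly coefC mul0r.
Qed.

Lemma pser_XM (c : R) f n : (pser_of_poly (c *: 'X) * f) n =
  if n is n'.+1 then c * f n' else 0.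
Proof.
rewrite pserME big_ord_recl {1}/pser_of_poly coefZ coefX mulr0 mul0r add0r.
case: n => [|n]; first by rewrite big_ord0.
rewrite big_ord_recl big1 ?addr0 => [|i _]; rewrite /pser_of_poly coefZ coefX.
  by rewrite mulr1 subSS subn0.
by rewrite mulr0 mul0r.
Qed.

(** Constant term 1 determines the other factor coefficient by coefficient, over any coefficient
    ring. *)
Lemma lreg_unipotent p : p`_0 = 1 -> GRing.lreg (pser_of_poly p).
Proof.
move=> p0; apply: mulrI0_lreg => f pf0.
apply: pserP => n; elim/ltn_ind: n => n IH.
have := congr1 (@^~ n) pf0; rewrite /= pserME big_ord_recl subn0.
rewrite {1}/pser_of_poly p0 mul1r big1 ?addr0 // => i _.
by rewrite IH ?mulr0 //= /bump /= add1n subnSK // leq_subr.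
Qed.

Lemma lreg_polyC (c : R) : GRing.lreg c -> GRing.lreg (pser_of_poly c%:P).
Proof.
move=> regc f g E; apply: pserP => n; apply: regc.
by rewrite -!pser_polyCM E.
Qed.

End PowerSeries.

(** * The recursion for cyclic sums over words *)

Section CycleRecursion.
Variables (R : comNzRingType) (x : nat -> R) (t : R) (N : nat).
Hypothesis regt : GRing.lreg (t - 1).

(** The weighted sum over the proper words of length [n] in the letters below
    [N] with first letter [a] and last letter [c]. *)
Fixpoint walk (n a c : nat) : R :=
  if n is n'.+1 then
    x a * (((n' == 0%N) && (a == c))%:R + \sum_(a.+1 <= b < N) walk n' b c
           + t * \sum_(0 <= b < a) walk n' b c)
  else 0.

(** The closing edge compares the first letter [a] with the last letter [c]: weight 1 if [a < c],
    [t] if [a > c], and equal ends are excluded. *)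
Definition cyclic_walk (n : nat) : R :=
  \sum_(0 <= c < N)
     (\sum_(0 <= a < c) walk n a c + t * \sum_(c.+1 <= a < N) walk n a c).

Definition elem_gen : {poly R} := \prod_(0 <= b < N) (1 + x b *: 'X).

Lemma coef_comp_scaleX (p : {poly R}) n : (p \Po (t *: 'X))`_n = t ^+ n * p`_n.
Proof.
elim/poly_ind: p n => [|p c IH] n; first by rewrite comp_poly0 !coef0 mulr0.
rewrite comp_polyD comp_polyM comp_polyX comp_polyC -scalerAr !coefD coefZ !coefMX !coefC.
case: n => [|n] /=; first by rewrite mulr0 expr0 mul1r.
by rewrite IH !addr0 exprS mulrA.
Qed.

Lemma deriv_prod_linear (u : nat -> R) :
  (\prod_(0 <= b < N) (1 + u b *: 'X))^`() =
  \sum_(0 <= c < N) u c *: (\prod_(0 <= b < c) (1 + u b *: 'X)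
                          * \prod_(c.+1 <= b < N) (1 + u b *: 'X)).
Proof.
elim: N => [|M IH]; first by rewrite !big_geq // derivC.
rewrite big_nat_recr //= derivM IH [RHS]big_nat_recr //= (big_geq (leqnn _)) mulr1.
rewrite derivD derivC derivZ derivX add0r mulr_suml; congr (_ + _); last first.
  by rewrite -scalerAr mulr1.
rewrite !big_nat; apply: eq_bigr => c /andP[_ cM].
by rewrite [in RHS](big_nat_recr M) //= -scalerAl mulrA.
Qed.

Let y b : pser R := pser_of_poly (x b *: 'X).
Let t' : pser R := pser_of_poly t%:P.
Let S a c : pser R := fun n => walk n a c.

Lemma walk_transfer a c :
  S a c = y a * ((a == c)%:R + \sum_(a.+1 <= b < N) S b c
                           + t' * \sum_(0 <= b < a) S b c).
Proof.
apply: pserP => -[|n]; rewrite pser_XM //= !pserDE pser_polyCM !pser_sumE.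
by congr (_ * (_ + _ + _)); case: (a == c) => //; rewrite andbC.
Qed.

Lemma prodA_poly i j :
  prodA y i j = pser_of_poly (\prod_(i <= b < j) (1 + x b *: 'X)).
Proof. by rewrite rmorph_prod; apply: eq_bigr => b _; rewrite rmorphD rmorph1. Qed.

Lemma prodB_poly i j :
  prodB y t' i j =
  pser_of_poly ((\prod_(i <= b < j) (1 + x b *: 'X)) \Po (t *: 'X)).
Proof.
rewrite rmorph_prod rmorph_prod; apply: eq_bigr => b _.
rewrite /t' /y -rmorphM -(rmorph1 (@pser_of_poly R)) -rmorphD; congr pser_of_poly.
rewrite /= comp_polyD comp_polyZ comp_polyX -[in RHS]polyC1 comp_polyC.
by rewrite mul_polyC !scalerA mulrC.
Qed.

(** The coefficient of z^n in the generating function identity, before division by [t - 1]. *)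
Lemma cycle_recursion_scaled n : (0 < n)%N ->
  \sum_(k < n.+1) (t - t ^+ k) * elem_gen`_k * cyclic_walk (n - k)
  = (n%:R * t ^+ n.-1 - n%:R * t ^+ 2 + (t + 1) * (t ^+ n - 1)) * elem_gen`_n.
Proof.
case: n => // n _.
have reg1 b : GRing.lreg (1 + y b).
  rewrite -(rmorph1 (@pser_of_poly R)) -rmorphD; apply: lreg_unipotent.
  by rewrite coefD coef1 coefZ coefX mulr0 addr0.
have reg2 b : GRing.lreg (1 + t' * y b).
  rewrite -rmorphM -(rmorph1 (@pser_of_poly R)) -rmorphD; apply: lreg_unipotent.
  by rewrite coefD coef1 mul_polyC !coefZ coefX !mulr0 addr0.
have reg3 : GRing.lreg (t' - 1).
  rewrite /t' -(rmorph1 (@pser_of_poly R)) -rmorphB -polyCB.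
  exact: lreg_polyC.
have := cycle_transfer reg1 reg2 reg3 (fun a c _ _ => walk_transfer a c).
rewrite prodA_poly prodB_poly -/elem_gen.
have -> : \sum_(0 <= c < N) y c * (prodA y 0 c * prodA y c.+1 N)
   = pser_of_poly ('X * elem_gen^`()).
  rewrite /elem_gen deriv_prod_linear mulr_sumr rmorph_sum; apply: eq_bigr => c _.
  by rewrite !prodA_poly -!rmorphM -scalerAl -scalerAr.
(* The singled-out factor is [y c], not [t' * y c], so this is z E'(tz) without the [t] of the chain
   rule. *)
have -> : \sum_(0 <= c < N) y c * (prodB y t' 0 c * prodB y t' c.+1 N)
   = pser_of_poly ('X * (elem_gen^`() \Po (t *: 'X))).
  rewrite /elem_gen deriv_prod_linear raddf_sum mulr_sumr rmorph_sum.
  apply: eq_bigr => c _.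
  rewrite !prodB_poly /y -!rmorphM /= comp_polyZ comp_polyM.
  by rewrite -scalerAl -scalerAr.
move=> /(congr1 (@^~ n.+1)) /=; rewrite /t'.
rewrite -!rmorphM -!rmorphXn -(rmorph1 (@pser_of_poly R)) -!rmorphD -!rmorphB.
rewrite -!rmorphM -!rmorphB -!rmorphD /= pserME => E.
transitivity (\sum_(i < n.+2) pser_of_poly (t%:P * elem_gen - (elem_gen \Po (t *: 'X))) i *
        (\sum_(0 <= c < N)
            (\sum_(0 <= a < c) S a c + pser_of_poly t%:P * \sum_(c.+1 <= a < N) S a c))
          (n.+1 - i)%N).
  apply: eq_bigr => i _; congr (_ * _).
    by rewrite /pser_of_poly /= coefB coefCM coef_comp_scaleX mulrBl.
  rewrite pser_sumE; apply: eq_bigr => c _.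
  by rewrite pserDE pser_polyCM !pser_sumE.
rewrite E /pser_of_poly /= !coefD coefN !coefCM !coefXM /= coefB !coef_comp_scaleX.
by rewrite coef_deriv /= -mulr_natl; ring.
Qed.

Definition qint (q : R) (n : nat) : R := \sum_(i < n) q ^+ i.

(** At [n = 2] the general formula would need [-1] = -1/q, giving (1 + q)^2 - 2q = 1 + q^2;
    truncated subtraction would give [0] = 0 instead, hence the separate case. *)
Definition cycle_coef (q : R) (n : nat) : R :=
  if n == 2 then 1 + q ^+ 2
  else (1 + q) * qint q n + n%:R * (q ^+ 2 * qint q (n - 3)).

Lemma cyclic_walk0 : cyclic_walk 0 = 0.
Proof.
by rewrite /cyclic_walk big1 // => c _; rewrite !big1 // mulr0 addr0.
Qed.

Lemma cyclic_walk1 : cyclic_walk 1 = 0.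
Proof.
have walk1 a c : a != c -> walk 1 a c = 0.
  by move=> /negPf /= ->; rewrite !big1 // mulr0 !addr0 mulr0.
rewrite /cyclic_walk big1 // => c _; rewrite !big_nat !big1 ?mulr0 ?addr0 // => a.
  by move=> /andP[ca _]; rewrite walk1 // gtn_eqF.
by move=> ac; rewrite walk1 // ltn_eqF.
Qed.

Lemma qint_sub1 (q : R) n : (q - 1) * qint q n = q ^+ n - 1.
Proof. by rewrite subrX1. Qed.

Lemma cycle_coef_scaled n : (t - 1) * cycle_coef t n.+2 =
  n.+2%:R * t ^+ n.+1 - n.+2%:R * t ^+ 2 + (t + 1) * (t ^+ n.+2 - 1).
Proof.
rewrite /cycle_coef; case: n => [|n] /=; first by ring.
rewrite !subSS subn0 mulrDr ![(t - 1) * (_ * _)]mulrCA !qint_sub1.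
rewrite !exprS; move: (n.+3%:R : R) => d; ring.
Qed.

Lemma elem_gen0 : elem_gen`_0 = 1.
Proof.
rewrite /elem_gen -horner_coef0 horner_prod big1 // => b _.
by rewrite hornerD hornerC hornerZ hornerX mulr0 addr0.
Qed.

(** The factor [t - t ^+ k] is [t - 1] for k = 0, zero for k = 1 and -(t - 1) t [k-1] for k >= 2, so
    [t - 1] cancels throughout. *)
Lemma cycle_recursion n :
  cyclic_walk n.+2 = cycle_coef t n.+2 * elem_gen`_n.+2 +
    \sum_(k < n.-1) t * qint t k.+1 * elem_gen`_k.+2 * cyclic_walk (n - k).
Proof.
have Q0 := cyclic_walk0; have Q1 := cyclic_walk1.
apply: regt; rewrite mulrDr mulrA cycle_coef_scaled.
have := cycle_recursion_scaled (ltn0Sn n.+1).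
rewrite big_ord_recl big_ord_recl /= subn0 elem_gen0 expr0 mulr1.
rewrite (_ : t - t ^+ _ = 0) ?mul0r ?add0r; last by rewrite /bump /= expr1 subrr.
move=> <-; rewrite -addrA -[LHS]addr0; congr (_ + _).
transitivity (\sum_(k < n.+1) (t - t ^+ k.+2) * elem_gen`_k.+2 * cyclic_walk (n - k)
  + (t - 1) * \sum_(k < n.-1) t * qint t k.+1 * elem_gen`_k.+2 * cyclic_walk (n - k)).
  apply/esym; case: n => [|n]; first by rewrite big_ord1 big_ord0 subnn Q0 !mulr0 addr0.
  (* The last two terms contain the cyclic sums of lengths 0 and 1, which vanish; hence the bound
     [n.-1]. *)
  rewrite big_ord_recr big_ord_recr /= subnn subSnn Q0 Q1 !mulr0 !addr0.
  rewrite mulr_sumr -big_split big1 // => k _ /=.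
  rewrite -!mulrA [(t - 1) * _]mulrCA [(t - 1) * _]mulrA qint_sub1.
  by rewrite [t ^+ k.+2]exprS; ring.
by congr (_ + _); apply: eq_bigr => k _; rewrite /bump /= !add1n !subSS.
Qed.
End CycleRecursion.

(** * Palindromic and unimodal polynomials *)

Section QIntegers.
Variables (R : comNzRingType) (q : R).

Lemma qint0 : qint q 0 = 0.
Proof. exact: big_ord0. Qed.

Lemma qintD m n : qint q (m + n) = qint q m + q ^+ m * qint q n.
Proof.
rewrite /qint big_split_ord /= mulr_sumr; congr (_ + _).
by apply: eq_bigr => i _; rewrite exprD.
Qed.

Lemma qint1 : qint q 1 = 1.
Proof. by rewrite /qint big_ord1 expr0. Qed.

Lemma qintS n : qint q n.+1 = qint q n + q ^+ n.
Proof. by rewrite -addn1 qintD qint1 mulr1. Qed.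

Lemma qint_recl n : qint q n.+1 = 1 + q * qint q n.
Proof. by rewrite -add1n qintD qint1 expr1. Qed.

(** One Clebsch-Gordan step: the longest centered interval splits off and leaves a shifted product
    of the same kind. *)
Lemma qintM a b :
  qint q a.+2 * qint q b.+2 = qint q (a + b).+3 + q * (qint q a.+1 * qint q b.+1).
Proof.
have -> : (a + b).+3 = (b.+2 + a.+1)%N by lia.
by rewrite qintD (qint_recl a.+1) mulrDl mul1r [in X in _ + X](qintS b.+1) !exprS; ring.
Qed.

Lemma qintM_1q n : (1 + q) * qint q n.+1 = qint q n.+2 + q * qint q n.
Proof. by rewrite (qintS n.+1) (qintS n) exprS; ring. Qed.

(** The gap in [1 + q ^+ 2] is filled by the second factor: both terms on the right are intervals
    with the same center. *)
Lemma qintM_1q2 n : (1 + q ^+ 2) * qint q n.+2 = qint q n.+4 + q ^+ 2 * qint q n.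
Proof. by rewrite (qintS n.+3) !qintS !exprS; ring. Qed.

End QIntegers.

Lemma coef_qintX (R : comNzRingType) n j : (qint 'X n : {poly R})`_j = (j < n)%:R.
Proof.
elim: n => [|n IH]; first by rewrite qint0 coef0.
rewrite qintS coefD IH coefXn ltnS.
by case: (ltngtP j n) => _; rewrite ?addr0 ?add0r.
Qed.

(** * The cone spanned by the elementary symmetric functions *)

(** Unsorted lists and repeated terms are allowed, so that sums and products are handled by
    induction; sorting and merging happen once, in [epos_e_le0]. *)
Inductive epos : fps -> Prop :=
| epos0 : epos 0
| eposS a l f : 0 <= a -> 0%N \notin l -> epos f ->
    epos (a *: elem_sym_part l + f).

Lemma eposD f g : epos f -> epos g -> epos (f + g).
Proof.
move=> pf pg; elim: pf => [|a l h a0 l0 _ IH]; first by rewrite add0r.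
by rewrite -addrA; apply: eposS.
Qed.

Lemma epos_part l : 0%N \notin l -> epos (elem_sym_part l).
Proof.
move=> l0; rewrite -[elem_sym_part l]scale1r -[X in epos X]addr0.
by apply: eposS => //; apply: epos0.
Qed.

Lemma eposMn f n : epos f -> epos (f *+ n).
Proof.
move=> pf; elim: n => [|n IH]; first by rewrite mulr0n; apply: epos0.
by rewrite mulrS; apply: eposD.
Qed.

Lemma elem_sym_part_cons k l : elem_sym_part (k :: l) = elem_sym k * elem_sym_part l.
Proof. exact: big_cons. Qed.

Lemma epos_mul k f : (0 < k)%N -> epos f -> epos (elem_sym k * f).
Proof.
move=> k0; elim => [|a l h a0 l0 _ IH]; first by rewrite mulr0; apply: epos0.
rewrite mulrDr mulrC -scalerAl [_ * elem_sym k]mulrC -elem_sym_part_cons; apply: eposS => //.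
by rewrite inE negb_or l0 andbT neq_ltn k0.
Qed.

Lemma epos_elem_symX k h : (0 < k)%N -> epos (elem_sym k ^+ h).
Proof.
move=> k0; elim: h => [|h IH]; last by rewrite exprS; apply: epos_mul.
by have := @epos_part [::]; rewrite /elem_sym_part big_nil expr0; apply.
Qed.

Lemma elem_sym_part_intpart (l : seq nat) : 0%N \notin l ->
  exists l' : intpart, elem_sym_part l' = elem_sym_part l.
Proof.
move=> l0; have lP : sorted geq (sort geq l) && (0%N \notin sort geq l).
  by rewrite mem_sort l0 andbT; apply: sort_sorted => x y; apply: leq_total.
by exists (IntPart lP); apply: perm_big; rewrite /= perm_sort.
Qed.

Lemma sum_finsupp_incl (c : {fsfun intpart -> rat with 0}) (S : {fset intpart}) :
  (finsupp c `<=` S)%fset ->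
  \sum_(l <- finsupp c) c l *: elem_sym_part l = \sum_(l <- S) c l *: elem_sym_part l.
Proof.
move=> sub; apply: big_fset_incl => // l _ lN.
by rewrite fsfun_dflt // scale0r.
Qed.

Lemma epos_e_le0 f : epos f -> e_le 0 f.
Proof.
elim => [|a l h a0 l0 _ [c [c0 Ec]]].
  exists [fsfun for (fun=> 0)]; split=> [l|]; first by rewrite fsfunE.
  by rewrite finsupp0 big_seq_fset0 subr0.
have [l' <-] := elem_sym_part_intpart l0.
(* One set containing both supports; the new coefficient is added to whatever [c] already has at
   [l']. *)
pose S := (l' |` finsupp c)%fset.
exists [fsfun c with l' |-> c l' + a]; split=> [m|].
  by rewrite fsfun_withE; case: eqP => // _; rewrite addr_ge0.
rewrite subr0 in Ec; rewrite subr0 Ec.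
rewrite (@sum_finsupp_incl c S) ?fsubsetU1 //.
rewrite (@sum_finsupp_incl _ S); last first.
  rewrite finsupp_with; case: ifP => _; rewrite ?fsubset_refl //.
  exact: fsubset_trans (fsubD1set _ _) (fsubsetU1 _ _).
have l'S : l' \in S by rewrite fset1U1.
rewrite !(bigD1_seq l' l'S (fset_uniq _)) /= fsfun_withE eqxx scalerDl addrA.
rewrite [a *: _ + _]addrC; congr (_ + _); apply: eq_bigr => m mN.
by rewrite fsfun_withE (negPf mN).
Qed.

Lemma epos_e_le f g : epos (g - f) -> e_le f g.
Proof. by move=> /epos_e_le0; rewrite /e_le subr0. Qed.

(** * The cone of palindromic unimodal polynomials *)

Section PalindromicUnimodal.

Definition shifted_qint (f : fps) (i m : nat) : {poly fps} := f%:P * 'X^i * qint 'X m.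

Lemma coef_shifted_qint f i m j :
  (shifted_qint f i m)`_j = if (i <= j < i + m)%N then f else 0.
Proof.
rewrite /shifted_qint -mulrA coefCM coefXnM coef_qintX; case: ltnP => ij /=; first by rewrite mulr0.
by rewrite ltn_subLR //; case: ltnP; rewrite ?mulr1 ?mulr0.
Qed.

(** The polynomials with coefficients in the cone [epos] that are palindromic
    with center [n / 2] and unimodal form the cone spanned by the
    [f t^i [n - 2i + 1]_t]. *)
Inductive punimod (n : nat) : {poly fps} -> Prop :=
| punimod0 : punimod n 0
| punimodS f i P : (i.*2 <= n)%N -> epos f -> punimod n P ->
    punimod n (shifted_qint f i (n - i.*2).+1 + P).

Variable n : nat.

Lemma punimodD P Q : punimod n P -> punimod n Q -> punimod n (P + Q).
Proof.
move=> pP pQ; elim: pP => [|f i P' ni pf _ IH]; first by rewrite add0r.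
by rewrite -addrA; apply: punimodS.
Qed.

Lemma punimod_sum (I : Type) (r : seq I) (F : I -> {poly fps}) :
  (forall i, punimod n (F i)) -> punimod n (\sum_(i <- r) F i).
Proof.
move=> pF; elim/big_ind: _ => //; first exact: punimod0.
exact: punimodD.
Qed.

(** The degrees run from [i] to [n - i]; the case [m = 0] is an empty interval. *)
Lemma punimod_qint f i m : epos f -> (n.+1 = i.*2 + m)%N ->
  punimod n (shifted_qint f i m).
Proof.
move=> pf; case: m => [|m] E.
  by rewrite /shifted_qint qint0 mulr0; apply: punimod0.
have -> : m = (n - i.*2)%N by lia.
rewrite -[shifted_qint _ _ _]addr0.
by apply: punimodS => //; [lia | apply: punimod0].
Qed.

Lemma punimod_qint2 f i a b : epos f -> (n = i.*2 + a + b)%N ->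
  punimod n (f%:P * 'X^i * (qint 'X a.+1 * qint 'X b.+1)).
Proof.
move=> pf; elim: a b i => [|a IH] b i E.
  by rewrite qint1 mul1r; apply: punimod_qint => //; lia.
case: b E => [|b] E; first by rewrite qint1 mulr1; apply: punimod_qint => //; lia.
rewrite qintM mulrDr; apply: punimodD; first by apply: punimod_qint => //; lia.
rewrite [_ * ('X * _)]mulrA -[f%:P * 'X^i * 'X]mulrA -exprSr; apply: IH; lia.
Qed.

Lemma punimod_size P : punimod n P -> (size P <= n.+1)%N.
Proof.
elim=> [|f i Q ni _ _ IH]; first by rewrite size_poly0.
apply/leq_sizeP => j jn; rewrite coefD (leq_sizeP _ _ IH) // addr0.
by rewrite coef_shifted_qint; case: ifP => //; lia.
Qed.

Lemma punimod_sym P j : punimod n P -> (j <= n)%N -> P`_j = P`_(n - j).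
Proof.
move=> pP jn; elim: pP => [|f i Q ni _ _ IH]; first by rewrite !coef0.
rewrite !coefD IH !coef_shifted_qint; congr (_ + _).
by congr (if _ then _ else _); lia.
Qed.

Lemma punimod_epos P j : punimod n P -> epos P`_j.
Proof.
elim=> [|f i Q ni pf _ IH]; first by rewrite coef0; apply: epos0.
rewrite coefD; apply: eposD => //; rewrite coef_shifted_qint.
by case: ifP => // _; apply: epos0.
Qed.

(** An interval symmetric about n/2 that contains j < n/2 also contains j + 1, so each generator
    contributes its coefficient or zero. *)
Lemma punimod_incr P j : punimod n P -> (j.*2 < n)%N -> epos (P`_j.+1 - P`_j).
Proof.
move=> pP jn; elim: pP => [|f i Q ni pf _ IH].
  by rewrite !coef0 subrr; apply: epos0.
rewrite !coefD opprD addrACA; apply: eposD => //; rewrite !coef_shifted_qint.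
do 2![case: ifP => ? ]; rewrite ?subr0 ?subrr //; try exact: epos0; lia.
Qed.

Lemma punimod_palindromic P : punimod n P -> palindromic n P.
Proof. by move=> pP; split=> [|j]; [apply: punimod_size | apply: punimod_sym]. Qed.

Lemma punimod_e_unimodal P : punimod n P -> e_unimodal P.
Proof.
move=> pP; exists n, n./2; split.
- by split; [apply: punimod_size | lia].
- by apply/epos_e_le0/punimod_epos.
- by move=> j jn; apply/epos_e_le/punimod_incr => //; lia.
- move=> j /andP[nj jn]; apply: epos_e_le.
  (* The descending half is the mirror image of the ascending one. *)
  rewrite (punimod_sym pP (ltnW jn)) (punimod_sym pP jn).
  have -> : (n - j = (n - j.+1).+1)%N by lia.
  by apply: punimod_incr => //; lia.
- by apply/epos_e_le0/punimod_epos.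
Qed.

End PalindromicUnimodal.

(** The factor t [k+1] is symmetric about (k+2)/2; centers add, and products of intervals split into
    intervals. *)
Lemma punimod_mul n k P : punimod n P ->
  punimod (n + k.+2) ('X * qint 'X k.+1 * (elem_sym k.+2)%:P * P).
Proof.
elim=> [|f i Q ni pf _ IH]; first by rewrite mulr0; apply: punimod0.
rewrite mulrDr; apply: punimodD => //; rewrite /shifted_qint.
rewrite [Z in punimod _ Z](_ : _ = (elem_sym k.+2 * f)%:P * 'X^(i.+1)
    * (qint 'X (n - i.*2).+1 * qint 'X k.+1)); last by rewrite polyCM exprS; ring.
by apply: punimod_qint2; [apply: epos_mul | lia].
Qed.

(** By [qintM_1q] the coefficient is a sum of intervals from degrees 0, 1, 2 to degrees n+3, n+2,
    n+1. *)
Lemma punimod_cycle_coef n :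
  punimod n.+3 (cycle_coef 'X n.+3 * (elem_sym n.+3)%:P).
Proof.
have pe : epos (elem_sym n.+3).
  by rewrite -[elem_sym _]expr1; apply: epos_elem_symX.
rewrite /cycle_coef /= !subSS subn0 qintM_1q.
have -> : (qint 'X n.+4 + 'X * qint 'X n.+2 + n.+3%:R * ('X ^+ 2 * qint 'X n))
    * (elem_sym n.+3)%:P =
  shifted_qint (elem_sym n.+3) 0 n.+4 + shifted_qint (elem_sym n.+3) 1 n.+2
  + shifted_qint (elem_sym n.+3 *+ n.+3) 2 n.
  rewrite /shifted_qint polyCMn -[_%:P *+ n.+3]mulr_natl.
  by move: (n.+3%:R : {poly fps}) => d; rewrite expr0 expr1; ring.
apply: punimodD; last by apply: punimod_qint; [exact: eposMn | lia].
by apply: punimodD; apply: punimod_qint => //; lia.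
Qed.

(** * Unrolling the recursion *)

Section Recursion.
Variable X : nat -> {poly fps}.
Hypothesis X_rec : forall n,
  X n.+2 = cycle_coef 'X n.+2 * (elem_sym n.+2)%:P +
    \sum_(k < n.-1) 'X * qint 'X k.+1 * (elem_sym k.+2)%:P * X (n - k).

(** The only part of [X n] that fails to be unimodal. *)
Definition even_part (n : nat) : {poly fps} :=
  if odd n then 0 else (1 + 'X^2) * 'X^(n./2.-1) * (elem_sym 2 ^+ n./2)%:P.

Lemma even_part_mul2 n : 'X * qint 'X 1 * (elem_sym 2)%:P * even_part n.+2 = even_part n.+4.
Proof.
rewrite /even_part /= !negbK qint1; case: ifP => _; first by rewrite mulr0.
by rewrite !polyC_exp !exprS; ring.
Qed.

(** As soon as an e_k with k >= 3 enters, [qintM_1q2] fills the gap of the exceptional part. *)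
Lemma punimod_even_part_mul n k :
  punimod (n.+2 + k.+3) ('X * qint 'X k.+2 * (elem_sym k.+3)%:P * even_part n.+2).
Proof.
rewrite /even_part; case: ifP => odd_n; first by rewrite mulr0; apply: punimod0.
have en : n.+2 = (n./2.+1).*2 by move: odd_n => /= ; lia.
have pe : epos (elem_sym 2 ^+ n.+2./2) by apply: epos_elem_symX.
rewrite [n.+2./2.-1]/=; move: (elem_sym 2 ^+ n.+2./2) pe => E /(epos_mul (ltn0Sn k.+2)) pe.
rewrite [Z in punimod _ Z](_ : _ = shifted_qint (elem_sym k.+3 * E) n./2.+1 k.+4
   + shifted_qint (elem_sym k.+3 * E) n./2.+3 k).
  by apply: punimodD; apply: punimod_qint => //; lia.
transitivity ((elem_sym k.+3 * E)%:P * 'X^(n./2.+1) *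
   ((1 + 'X^2) * qint 'X k.+2)).
  by rewrite polyCM [in RHS]exprS; ring.
by rewrite qintM_1q2 /shifted_qint !exprS; ring.
Qed.

Lemma recursion_decomposition n : exists2 Z, punimod n.+2 Z & X n.+2 = Z + even_part n.+2.
Proof.
elim/ltn_ind: n => -[|[|n]] IH.
- exists 0; first exact: punimod0.
  by rewrite X_rec big_ord0 addr0 add0r /cycle_coef /even_part /= expr1 expr0 mulr1.
- exists (cycle_coef 'X 3 * (elem_sym 3)%:P); first exact: punimod_cycle_coef.
  by rewrite X_rec big_ord0.
(* The terms with e_3 and beyond lie in the cone, exceptional part included. *)
have decomp (k : 'I_n) : exists Z, punimod n.+4 Z /\
    'X * qint 'X k.+2 * (elem_sym k.+3)%:P * X (n.+2 - k.+1) = Z.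
  case: k => k /= kn; have [|Z pZ EZ] := IH (n - k.+1)%N; first by lia.
  exists ('X * qint 'X k.+2 * (elem_sym k.+3)%:P * X (n.+2 - k.+1)); split=> //.
  have -> : (n.+2 - k.+1 = (n - k.+1).+2)%N by lia.
  rewrite EZ mulrDr.
  have -> : (n.+4 = (n - k.+1).+2 + k.+3)%N by lia.
  by apply: punimodD; [exact: punimod_mul | exact: punimod_even_part_mul].
(* The e_2 term alone carries the exceptional part from length [n.+2] to [n.+4]. *)
have [|Z pZ EZ] := IH n; first by lia.
exists (cycle_coef 'X n.+4 * (elem_sym n.+4)%:P
  + \sum_(k < n) 'X * qint 'X k.+2 * (elem_sym k.+3)%:P * X (n.+2 - k.+1)
  + 'X * qint 'X 1 * (elem_sym 2)%:P * Z).
  apply: punimodD; last by rewrite -addn2; exact: punimod_mul.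
  apply: punimodD; first exact: punimod_cycle_coef.
  by apply: punimod_sum => k; have [Z' [pZ' ->]] := decomp k.
rewrite X_rec /= big_ord_recl subn0 EZ mulrDr even_part_mul2.
rewrite [X in _ + X = _](_ : _ = 'X * qint 'X 1 * (elem_sym 2)%:P * Z
   + even_part n.+4
   + \sum_(k < n) 'X * qint 'X k.+2 * (elem_sym k.+3)%:P * X (n.+2 - k.+1)) //.
by ring.
Qed.

End Recursion.

(** * Colorings as words *)

Local Open Scope mset_scope.
Local Open Scope ring_scope.

Section WordExpansion.
Variables (R : comNzRingType) (x : nat -> R) (t : R) (N : nat).

(** The value 0 on equal letters encodes properness, so sums may run over all words. *)
Definition step (a b : nat) : R := if (a < b)%N then 1 else if (b < a)%N then t else 0.

Fixpoint path_weight (a : nat) (s : seq nat) : R :=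
  x a * (if s is b :: s' then step a b * path_weight b s' else 1).

Lemma sum_step (a : nat) (F : nat -> R) : (a < N)%N ->
  \sum_(a.+1 <= b < N) F b + t * \sum_(0 <= b < a) F b
  = \sum_(b < N) step a b * F b.
Proof.
move=> aN; rewrite -(big_mkord predT (fun b => step a b * F b)) (sum_nat_split3 _ aN).
rewrite {2}/step ltnn mul0r addr0 addrC mulr_sumr; congr (_ + _).
  rewrite !big_nat; apply: eq_bigr => b /andP[_ ba].
  by rewrite /step ltnNge (ltnW ba) /= ba.
by rewrite !big_nat; apply: eq_bigr => b /andP[ab _]; rewrite /step ab mul1r.
Qed.

Lemma sum_step_r (c : nat) (F : nat -> R) : (c < N)%N ->
  \sum_(0 <= a < c) F a + t * \sum_(c.+1 <= a < N) F a
  = \sum_(a < N) step a c * F a.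
Proof.
move=> cN; rewrite -(big_mkord predT (fun a => step a c * F a)) (sum_nat_split3 _ cN).
rewrite {2}/step ltnn mul0r addr0 mulr_sumr; congr (_ + _).
  by rewrite !big_nat; apply: eq_bigr => a /andP[_ ac]; rewrite /step ac mul1r.
rewrite !big_nat; apply: eq_bigr => a /andP[ca _].
by rewrite /step ltnNge (ltnW ca) /= ca.
Qed.

Lemma sum_tuple_cons (T : finType) (n : nat) (F : seq T -> R) :
  \sum_(w : n.+1.-tuple T) F w = \sum_(a : T) \sum_(s : n.-tuple T) F (a :: s).
Proof.
rewrite pair_big /=.
rewrite (reindex (fun p : T * n.-tuple T => [tuple of p.1 :: p.2])) //=.
exists (fun w : n.+1.-tuple T => (thead w, [tuple of behead w])) => [[a s] _ | w _] /=.
  by congr (_, _); apply: val_inj.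
by rewrite [RHS]tuple_eta.
Qed.

Lemma sum_tuple0 (T : finType) (F : seq T -> R) : \sum_(w : 0.-tuple T) F w = F [::].
Proof.
rewrite (big_pred1 [tuple]) // => w.
by apply/esym/eqP/val_inj; rewrite /= (tuple0 w).
Qed.

Lemma walk_sum n (a : nat) c : (a < N)%N ->
  walk x t N n.+1 a c =
  \sum_(s : n.-tuple 'I_N) (last a (map val s) == c)%:R * path_weight a (map val s).
Proof.
elim: n a => [|n IH] a aN.
  rewrite (sum_tuple0 (fun s => (last a (map val s) == c)%:R * path_weight a (map val s))).
  rewrite /= !big1 ?mulr0 // !addr0 mulr1.
  by rewrite mulrC.
rewrite [LHS]/= -/(walk x t N n.+1) add0r sum_step //.
rewrite (sum_tuple_cons _ (fun s => (last a (map val s) == c)%:R * path_weight a (map val s))).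
rewrite mulr_sumr; apply: eq_bigr => b _.
rewrite -[X in step a b * X]/(walk x t N n.+1 b c) IH // !mulr_sumr.
by apply: eq_bigr => s _ /=; ring.
Qed.

Local Arguments walk : simpl never.

Lemma cyclic_walk_sum n : cyclic_walk x t N n.+1 =
  \sum_(w : n.+1.-tuple 'I_N)
     (if map val w is a :: s then step a (last a s) * path_weight a s else 0).
Proof.
rewrite (sum_tuple_cons _ (fun w => if map val w is a :: s then
   step a (last a s) * path_weight a s else 0)) /=.
rewrite /cyclic_walk big_mkord.
transitivity (\sum_(c < N) \sum_(a < N) step a c * walk x t N n.+1 a c).
  by apply: eq_bigr => c _; rewrite (sum_step_r (fun a => walk x t N n.+1 a c)).
rewrite exchange_big /=; apply: eq_bigr => a _.
under eq_bigr => c _ do rewrite walk_sum // mulr_sumr.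
rewrite exchange_big /=; apply: eq_bigr => s _.
have lastN : (last (val a) (map val s) < N)%N by rewrite last_map; apply: ltn_ord.
(* The word determines its last letter, so one value of [c] survives. *)
rewrite (bigD1 (Ordinal lastN)) //= eqxx mul1r big1 ?addr0 // => c cN.
rewrite (_ : _ == _ = false) ?mul0r ?mulr0 //.
by apply: contraNF cN => /eqP E; apply/eqP/val_inj.
Qed.

Lemma path_weightE a s : path_weight a s =
  (\prod_(b <- a :: s) x b) *
  \prod_(i < size s) step (nth 0%N (a :: s) i) (nth 0%N (a :: s) i.+1).
Proof.
elim: s a => [|b s IH] a; first by rewrite big_ord0 big_seq1.
rewrite [path_weight _ _]/= -/(path_weight b s) IH [in RHS]big_cons [in RHS]big_ord_recl.
by rewrite !mulrA [x a * _ * _]mulrAC.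
Qed.

(** For [p = 0] both factors are [F 0 1], in agreement with the double edge. *)
Lemma prod_cycle_edges p (F : nat -> nat -> R) :
  \prod_(e <- cycle_edges p.+2) F (val e.1) (val e.2) =
  (\prod_(i < p.+1) F i i.+1) * F 0%N p.+1.
Proof.
rewrite big_cat /= !big_filter !big_enum_cond /=; congr (_ * _).
  rewrite -(pair_big_dep xpredT (fun i j : 'I_p.+2 => val j == (val i).+1)
    (fun i j => F (val i) (val j))) /=.
  (* Each [i] has the single successor [i.+1], except the last vertex, which has none. *)
  transitivity (\prod_(i < p.+2) if (i.+1 < p.+2)%N then F i i.+1 else 1).
    by apply: eq_bigr => i _; rewrite (big_ord1_eq _ (F i)).
  rewrite big_ord_recr /= ltnn mulr1; apply: eq_bigr => i _.
  by rewrite ltnS ltn_ord.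
rewrite -(pair_big_dep (fun i : 'I_p.+2 => val i == 0%N)
  (fun i j : 'I_p.+2 => val j == p.+1) (fun i j => F (val i) (val j))) /=.
rewrite (big_ord1_eq _ (fun i => \prod_(j < p.+2 | val j == p.+1) F i j)) /=.
by rewrite (big_ord1_eq _ (F 0%N)) ltnSn.
Qed.

Lemma cyclic_walk_colorings p : cyclic_walk x t N p.+2 =
  \sum_(w : p.+2.-tuple 'I_N) (\prod_(b <- w) x b) *
     \prod_(e <- cycle_edges p.+2) step (tnth w e.1) (tnth w e.2).
Proof.
rewrite cyclic_walk_sum; apply: eq_bigr => w _.
transitivity ((\prod_(b <- map val w) x b) * \prod_(e <- cycle_edges p.+2)
    step (nth 0%N (map val w) (val e.1)) (nth 0%N (map val w) (val e.2))); last first.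
  rewrite big_map; congr (_ * _); apply: eq_bigr => e _.
  rewrite !(nth_map (tnth_default w e.1)) ?size_tuple ?ltn_ord //.
  by rewrite !(tnth_nth (tnth_default w e.1)).
rewrite (prod_cycle_edges _ (fun i j => step (nth 0%N (map val w) i) (nth 0%N (map val w) j))).
have : size (map val w) = p.+2 by rewrite size_map size_tuple.
case: (map val w) => // a s [sz_s]; rewrite path_weightE sz_s.
by rewrite [in RHS]mulrA [in RHS]mulrC (_ : nth _ _ p.+1 = last a s) // -sz_s nth_last.
Qed.

End WordExpansion.

(** * Restriction to finitely many variables *)

Definition var (c : nat) : fps := fun m => (m == [mset c])%:R.

Lemma fps_coefM (f g : fps) m : (f * g) m = fps_mul f g m.
Proof. by []. Qed.
Lemma fps_coefD (f g : fps) m : (f + g) m = f m + g m.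
Proof. by []. Qed.
Lemma fps_coef0 m : (0 : fps) m = 0.
Proof. by []. Qed.
Lemma fps_coef1 m : (1 : fps) m = (m == mset0)%:R.
Proof. by []. Qed.

Lemma fps_coef_sum I (r : seq I) (P : pred I) (F : I -> fps) m :
  (\sum_(i <- r | P i) F i) m = \sum_(i <- r | P i) F i m.
Proof. by elim/big_rec2: _ => // i f y _ <-. Qed.

Lemma coef_varM c (f : fps) m :
  (var c * f) m = if c \in m then f (m `\ c) else 0.
Proof.
rewrite fps_coefM /fps_mul; case: ifP => cm; last first.
  rewrite big1_seq // => a /=; rewrite mem_submsets => am; apply: big1 => b _.
  rewrite /var (_ : _ == _ = false) ?mul0r //; apply/eqP => E; rewrite E in am.
  by move/msubset_subset: am => /(_ c); rewrite in_mset1 eqxx cm => /(_ isT).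
have sub1 : [mset c] `<=` m.
  by apply/msubsetP => b; rewrite msetnE; case: eqP => // ->; rewrite mset_gt0.
rewrite (bigD1_seq [mset c]) ?fset_uniq ?mem_submsets //=.
rewrite [X in _ + X]big1 ?addr0; last first.
  by move=> a aN; apply: big1 => b _; rewrite /var (negPf aN) mul0r.
rewrite big_mkcond (bigD1_seq (m `\ c)) ?fset_uniq //=; last first.
  by rewrite mem_submsets; apply/msubsetP => b; rewrite msetB1E leq_subr.
rewrite msetB1K // eqxx /var eqxx mul1r big1 ?addr0 // => b bN.
by case: eqP => // E; rewrite -E msetD1K eqxx in bN.
Qed.

Lemma seq_mset_cons (c : nat) s : seq_mset (c :: s) = c +` seq_mset s.
Proof. by apply/msetP => b; rewrite mset1DE !mset_seqE /= eq_sym. Qed.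

Lemma coef_prod_var (s : seq nat) m :
  (\prod_(b <- s) var b : fps) m = (seq_mset s == m)%:R.
Proof.
elim: s m => [|c s IH] m.
  by rewrite big_nil fps_coef1 eq_sym -(seq_mset_id mset0) enum_mset0.
rewrite big_cons coef_varM seq_mset_cons IH; case: ifP => cm.
  congr (nat_of_bool _)%:R; apply/eqP/eqP => [-> | <-]; first by rewrite msetB1K.
  by rewrite msetD1K.
by case: eqP => // E; rewrite -E in_mset1D eqxx in cm.
Qed.

Definition elem_sym_lt (N k : nat) : fps := fun m =>
  [&& size m == k, uniq m & all (fun c => c < N)%N m]%:R.

(** The monomials are split according to whether the variable of index [N] divides them. *)
Lemma elem_sym_ltS N k :
  elem_sym_lt N.+1 k.+1 = elem_sym_lt N k.+1 + var N * elem_sym_lt N k.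
Proof.
apply/fpsP => m; rewrite fps_coefD coef_varM /elem_sym_lt; case: ifP => Nm; last first.
  rewrite addr0; congr (nat_of_bool [&& _, _ & _])%:R.
  apply: eq_in_all => c cm; rewrite ltnS leq_eqVlt.
  by case: eqP => // E; rewrite E Nm in cm.
have Em : perm_eq m (N :: (m `\ N)).
  by apply/eq_seq_msetP; rewrite seq_mset_cons !seq_mset_id msetB1K.
rewrite !(perm_size Em) !(perm_uniq Em) !(perm_all _ Em) /= ltnn ltnSn !andbF /= add0r eqSS.
congr (nat_of_bool (_ && _))%:R; rewrite andbC andbA [RHS]andbC; congr (_ && _).
rewrite andbC; apply/andP/allP => [[Nm' /allP le] c cm | lt].
  have := le c cm; rewrite ltnS leq_eqVlt => /orP[/eqP E|//].
  by move: cm; rewrite E (negPf Nm').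
split; first by apply/negP => /lt; rewrite ltnn.
by apply/allP => c /lt; apply: ltnW.
Qed.

Lemma elem_sym_lt0 N : elem_sym_lt N 0 = 1.
Proof.
apply/fpsP => m; rewrite fps_coef1 /elem_sym_lt; congr (nat_of_bool _)%:R.
apply/idP/eqP => [/andP[/nilP m0 _] | ->]; last by rewrite enum_mset0.
by rewrite -(seq_mset_id m) m0; apply/msetP => c; rewrite mset_seqE mset0E.
Qed.

Lemma elem_sym_lt_gt N k : (N < k)%N -> elem_sym_lt N k = 0.
Proof.
elim: N k => [|N IH] [|k] // Nk; last by rewrite elem_sym_ltS !IH ?mulr0 ?addr0 ?(ltnW Nk).
apply/fpsP => m; rewrite fps_coef0 /elem_sym_lt.
by case: (m : seq nat) => [|a s] //=; rewrite !andbF.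
Qed.

Lemma coef_elem_gen N k :
  (elem_gen (fun b => (var b)%:P : {poly fps}) N)`_k = (elem_sym_lt N k)%:P.
Proof.
rewrite /elem_gen; elim: N k => [|N IH] k.
  rewrite big_geq // coef1; case: k => [|k]; first by rewrite elem_sym_lt0.
  by rewrite elem_sym_lt_gt.
rewrite big_nat_recr //= mulrDr mulr1 coefD IH -scalerAr coefZ coefMX.
case: k => [|k] /=; first by rewrite mulr0 addr0 !elem_sym_lt0.
by rewrite IH elem_sym_ltS polyCD polyCM.
Qed.

Definition below (N : nat) (m : {mset nat}) := all (fun c => c < N)%N m.

(** Equality after setting the variables of index at least [N] to zero: the form in which identities
    pass between words over a finite alphabet and series in infinitely many variables. *)
Definition agree (N : nat) (P Q : {poly fps}) :=
  forall j m, below N m -> P`_j m = Q`_j m.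

Lemma agree_refl N P : agree N P P.
Proof. by []. Qed.

Lemma agree_sym N P Q : agree N P Q -> agree N Q P.
Proof. by move=> PQ j m mN; rewrite PQ. Qed.

Lemma agreeD N P P' Q Q' :
  agree N P P' -> agree N Q Q' -> agree N (P + Q) (P' + Q').
Proof. by move=> PP QQ j m mN; rewrite !coefD !fps_coefD PP ?QQ. Qed.

Lemma agree_sum N (I : Type) (r : seq I) (F G : I -> {poly fps}) :
  (forall i, agree N (F i) (G i)) -> agree N (\sum_(i <- r) F i) (\sum_(i <- r) G i).
Proof.
by move=> FG; apply: (big_ind2 (agree N)) => // *; apply: agreeD.
Qed.

Lemma below_sub N m a : below N m -> a `<=` m -> below N a.
Proof. by move=> /allP mN /msubset_subset am; apply/allP => c /am /mN. Qed.

(** Divisors of a monomial below [N] are again below [N]. *)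
Lemma agreeM N P P' Q Q' :
  agree N P P' -> agree N Q Q' -> agree N (P * Q) (P' * Q').
Proof.
move=> PP QQ j m mN; rewrite !coefM !fps_coef_sum; apply: eq_bigr => i _.
rewrite !fps_coefM /fps_mul; apply: eq_big_seq => a; rewrite mem_submsets => am.
rewrite big_seq_cond [RHS]big_seq_cond; apply: eq_bigr => b /andP[+ _].
rewrite mem_submsets => bm.
by rewrite PP ?QQ //; apply: below_sub mN _.
Qed.

Lemma agree_elem_sym N k : agree N (elem_sym k)%:P (elem_sym_lt N k)%:P.
Proof.
move=> j m mN; rewrite !coefC; case: eqP => // _.
by rewrite /elem_sym /elem_sym_lt -/(below N m) mN andbT.
Qed.

Lemma agree_eq P Q : (forall N, agree N P Q) -> P = Q.
Proof.
move=> PQ; apply/polyP => j; apply/fpsP => m.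
(* One more than the largest index in [m], so that [m] lies below it. *)
apply: (PQ (\max_(c <- (m : seq nat)) c).+1); apply/allP => c cm.
by rewrite ltnS; apply: (@leq_bigmax_seq _ _ predT id).
Qed.


(** * Colorings of a graph as words *)

Section Colorings.
Variable n : nat.
Implicit Types (E : seq ('I_n * 'I_n)) (k : 'I_n -> nat).

Definition increasing E := all (fun e : 'I_n * 'I_n => e.1 < e.2)%N E.

Lemma prod_step_edges (R : comNzRingType) E k : increasing E ->
  \prod_(e <- E) step ('X : {poly R}) (k e.1) (k e.2) =
  if proper E k then 'X^(des E k) else 0.
Proof.
elim: E => [|e E IH]; first by rewrite big_nil expr0.
rewrite /increasing /= => /andP[lt_e incE]; rewrite big_cons IH // /des /= -/(des E k) lt_e /step.
case: (ltngtP (k e.1) (k e.2)) => _ /=; rewrite ?mul1r ?mul0r //.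
by case: ifP => _; rewrite ?mulr0 // add1n exprS.
Qed.

Lemma des_size E k : (des E k <= size E)%N.
Proof. exact: count_size. Qed.

(** The condition [xmon k' == m] forces every color into the support of [m], so both alphabets give
    the same colorings. *)
Lemma card_colorings (P : ('I_n -> nat) -> bool) N m : below N m ->
  #|[set k : {ffun 'I_n -> finsupp m} |
      let k' := fun i => val (k i) in P k' && (xmon k' == m)]| =
  #|[set w : n.-tuple 'I_N |
      let k' := fun i => val (tnth w i) in P k' && (xmon k' == m)]|.
Proof.
move=> mN; have ltN (c : finsupp m) : (val c < N)%N.
  by move: (allP mN (val c)); apply; rewrite -msuppE; apply: valP.
pose word (k : {ffun 'I_n -> finsupp m}) := [tuple Ordinal (ltN (k i)) | i < n].
have tnth_word (f : {ffun 'I_n -> finsupp m}):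
    (fun i => val (tnth (word f) i)) = (fun i => val (f i)).
  by apply: funext => i; rewrite tnth_mktuple.
have word_inj : injective word.
  move=> f g E; apply/ffunP => i; apply: val_inj.
  have fi := congr1 (@^~ i) (tnth_word f); have gi := congr1 (@^~ i) (tnth_word g).
  by rewrite -[LHS]fi -[RHS]gi E.
rewrite -(card_imset _ word_inj); apply: eq_card => w; rewrite !inE.
apply/imsetP/idP => [[f] | /andP[Pw /eqP mw]].
  by rewrite inE => Pk ->; rewrite tnth_word.
have wm i : val (tnth w i) \in finsupp m.
  have : val (tnth w i) \in xmon (fun i => val (tnth w i)).
    by rewrite (perm_mem (perm_eq_seq_mset _)); apply: map_f; rewrite mem_enum.
  by rewrite mw -msuppE.
pose f := [ffun i => FSetSub (wm i)].
have fw : (fun i => val (f i)) = (fun i => val (tnth w i)).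
  by apply: funext => i; rewrite ffunE.
exists f; first by rewrite inE fw; apply/andP; rewrite mw.
apply: eq_from_tnth => i; apply: val_inj.
by rewrite tnth_mktuple /= ffunE.
Qed.

Lemma agree_chromatic N E : increasing E ->
  agree N (chromatic_qsym E)
    (\sum_(w : n.-tuple 'I_N) (\prod_(b <- w) (var b)%:P) *
       \prod_(e <- E) step 'X (tnth w e.1) (tnth w e.2)).
Proof.
move=> incE j m mN; rewrite coef_sum fps_coef_sum coef_poly.
transitivity (#|[set w : n.-tuple 'I_N | let k' := fun i => val (tnth w i) in
    (proper E k' && (des E k' == j)) && (xmon k' == m)]|%:R : rat).
  case: ltnP => jE.
    rewrite -(card_colorings (fun k' => proper E k' && (des E k' == j)) mN).
    congr (_%:R); apply: eq_card => k; rewrite !inE /=.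
    by rewrite -andbA [(des _ _ == _) && _]andbC.
  (* Beyond the number of edges the polynomial has no coefficient, and no word has that many
     descents. *)
  rewrite fps_coef0 (_ : #|_| = 0%N) //; apply: eq_card0 => w; rewrite !inE /=.
  by rewrite (ltn_eqF (leq_ltn_trans (des_size _ _) jE)) andbF.
rewrite -sum1_card natr_sum big_mkcond /=; apply: eq_bigr => w _.
rewrite (prod_step_edges _ (fun i => val (tnth w i)) incE) inE /=.
rewrite -(rmorph_prod polyC) coefCM.
case: (proper _ _) => /=; last by rewrite coef0 mulr0.
rewrite coefXn [j == _]eq_sym; case: (des _ _ == j) => /=; last by rewrite mulr0.
rewrite mulr1 -(big_map val predT var) coef_prod_var /xmon.
rewrite (_ : [seq val (tnth w i) | i <- enum 'I_n] = map val w); first by case: eqP.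
by rewrite (map_comp val (tnth w)) map_tnth_enum.
Qed.

End Colorings.

Lemma increasing_cycle_edges p : increasing (cycle_edges p.+2).
Proof.
rewrite /increasing /cycle_edges all_cat !all_filter; apply/andP; split; apply/allP => e _ /=.
  by apply/implyP => /eqP ->.
by apply/implyP => /andP[/eqP -> /eqP ->].
Qed.

Lemma agree_cycle N p :
  agree N (chromatic_qsym (cycle_edges p.+2))
    (cyclic_walk (fun b => (var b)%:P) 'X N p.+2).
Proof.
by rewrite cyclic_walk_colorings; apply/agree_chromatic/increasing_cycle_edges.
Qed.

Lemma chromatic_cycle_recursion n :
  chromatic_qsym (cycle_edges n.+2) = cycle_coef 'X n.+2 * (elem_sym n.+2)%:P +
    \sum_(k < n.-1) 'X * qint 'X k.+1 * (elem_sym k.+2)%:P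
                      * chromatic_qsym (cycle_edges (n - k)).
Proof.
(* A monic polynomial can be cancelled over any coefficient ring. *)
have regX : GRing.lreg ('X - 1 : {poly fps}).
  by rewrite -polyC1; apply/monic_lreg/monicXsubC.
apply: agree_eq => N j m mN; rewrite (@agree_cycle N n j m mN) (cycle_recursion _ _ regX).
move: j m mN; apply: agreeD.
  apply: agreeM; first exact: agree_refl.
  by rewrite coef_elem_gen; apply/agree_sym/agree_elem_sym.
apply: agree_sum => k; apply: agreeM.
  apply: agreeM; first exact: agree_refl.
  by rewrite coef_elem_gen; apply/agree_sym/agree_elem_sym.
have -> : (n - k = (n - k.+2).+2)%N by case: k => k /= kn; lia.
exact/agree_sym/agree_cycle.
Qed.

Lemma chromatic_cycle_decomposition n : exists2 Z, punimod n.+2 Z &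
  chromatic_qsym (cycle_edges n.+2) = Z + even_part n.+2.
Proof.
exact: (recursion_decomposition (X := fun n => chromatic_qsym (cycle_edges n))
          chromatic_cycle_recursion).
Qed.

(** * Two variables and the failure of unimodality *)

Lemma even_partE h : even_part h.*2.+2 =
  shifted_qint (elem_sym 2 ^+ h.+1) h 1 + shifted_qint (elem_sym 2 ^+ h.+1) h.+2 1.
Proof.
rewrite /even_part /shifted_qint /= odd_double /= doubleK qint1 !mulr1.
by rewrite -[h.+2]addn2 exprD; move: (_%:P) => e; ring.
Qed.

Lemma elem_sym_part_ge0 l m : 0 <= elem_sym_part l m.
Proof.
elim: l m => [|k l IH] m.
  by rewrite /elem_sym_part big_nil fps_coef1 ler0n.
rewrite elem_sym_part_cons fps_coefM; do 2![apply: sumr_ge0 => ? _].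
by rewrite mulr_ge0 // /elem_sym ler0n.
Qed.

Lemma e_le_coef f g m : e_le f g -> f m <= g m.
Proof.
move=> [c [c0 E]]; rewrite -subr_ge0.
have -> : g m - f m = (g - f) m by [].
rewrite E fps_coef_sum; apply: sumr_ge0 => l _.
by rewrite -[X in _ <= X]/(c l * elem_sym_part l m) mulr_ge0 // elem_sym_part_ge0.
Qed.

Lemma agree_elem_sym_gt2 k : agree 2 (elem_sym k.+3)%:P 0.
Proof. by have := @agree_elem_sym 2 k.+3; rewrite elem_sym_lt_gt. Qed.

Lemma agree_mul_gt2 k P Q : agree 2 (P * (elem_sym k.+3)%:P * Q) 0.
Proof.
rewrite -[X in agree _ _ X](mul0r Q) -[X in agree _ _ (X * _)](mulr0 P).
apply: agreeM; last exact: agree_refl.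
by apply: agreeM; [exact: agree_refl | exact: agree_elem_sym_gt2].
Qed.

(** In two variables e_k vanishes for k >= 3, so the recursion reduces to its e_2 term. *)
Lemma agree_even_part h :
  agree 2 (chromatic_qsym (cycle_edges h.*2.+2)) (even_part h.*2.+2).
Proof.
elim: h => [|h IH]; rewrite chromatic_cycle_recursion.
  rewrite big_ord0 addr0 /cycle_coef /even_part /= expr0 expr1 mulr1.
  exact: agree_refl.
rewrite doubleS /= big_ord_recl subn0 -[even_part _]add0r; apply: agreeD.
  by rewrite -[_ * _]mulr1; apply: agree_mul_gt2.
rewrite -[even_part _]addr0; apply: agreeD.
  by rewrite -even_part_mul2; apply: agreeM; [exact: agree_refl |].
apply: (big_ind (fun P => agree 2 P 0)) => [|P Q P0 Q0|k _].
- exact: agree_refl.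
- by rewrite -[0]addr0; apply: agreeD.
- exact: agree_mul_gt2.
Qed.

Definition alternating h : {mset nat} := seq_mset (flatten (nseq h [:: 0%N; 1%N])).

(** In two variables e_2 is the product of the variables, and its power is this single monomial. *)
Lemma coef_alternating h : (elem_sym 2 ^+ h) (alternating h) = 1.
Proof.
have ltm : below 2 (alternating h).
  rewrite /below (perm_all _ (perm_eq_seq_mset _)).
  by elim: h => //= h ->.
have e2 : elem_sym_lt 2 2 = var 0 * var 1.
  have e1 : elem_sym_lt 1 1 = var 0.
    by rewrite elem_sym_ltS (elem_sym_lt_gt (ltnSn 0)) elem_sym_lt0 add0r mulr1.
  by rewrite elem_sym_ltS (elem_sym_lt_gt (ltnSn 1)) e1 add0r; apply: mulrC.
have E : agree 2 ((elem_sym 2)%:P ^+ h) ((var 0 * var 1)%:P ^+ h).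
  elim: h {ltm} => [|h IH]; first exact: agree_refl.
  by rewrite !exprS; apply: agreeM => //; rewrite -e2; apply: agree_elem_sym.
have := E 0%N _ ltm; rewrite -!polyC_exp !coefC /= => ->.
rewrite /alternating (_ : (var 0 * var 1) ^+ h =
  \prod_(b <- flatten (nseq h [:: 0%N; 1%N])) var b).
  by rewrite coef_prod_var eqxx.
elim: h {ltm E} => [|h IH]; first by rewrite big_nil.
by rewrite exprS IH /= !big_cons mulrA.
Qed.

(** These are the two proper 2-colorings of the cycle of length 2h + 2: one has h descents, the
    other h + 2. *)
Lemma chromatic_alternating h j :
  (chromatic_qsym (cycle_edges h.*2.+2))`_j (alternating h.+1)
  = ((j == h) || (j == h.+2))%:R.
Proof.
rewrite (@agree_even_part h); last first.
  rewrite /below (perm_all _ (perm_eq_seq_mset _)).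
  by elim: h.+1 => //= k ->.
rewrite even_partE coefD !coef_shifted_qint fps_coefD.
rewrite (_ : (h <= j < h + 1)%N = (j == h)); last by lia.
rewrite (_ : (h.+2 <= j < h.+2 + 1)%N = (j == h.+2)); last by lia.
have [-> | _] := eqVneq j h.
  by rewrite (_ : (h == h.+2) = false) ?coef_alternating ?fps_coef0 ?addr0 //; lia.
by case: eqP => _; rewrite !fps_coef0 ?coef_alternating add0r.
Qed.

Lemma not_e_unimodal h : ~ e_unimodal (chromatic_qsym (cycle_edges h.*2.+2)).
Proof.
have C := chromatic_alternating h.
move=> [m [c [[sz cm] _ up down _]]].
(* A peak beyond [h.+1] would force 1 <= 0 from degree [h] to [h.+1]; a peak at or before [h.+1]
   forces it from [h.+2] back to [h.+1]. *)
have [ch | hc] := leqP c h.+1; last first.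
  have := e_le_coef (alternating h.+1) (up h (ltnW hc)); rewrite !C eqxx /=.
  by rewrite (_ : (_ || _) = false) ?ler10 //; lia.
(* The descent at [h.+1] is available only if [m] exceeds it; otherwise the size bound kills the
   nonzero coefficient at [h.+2]. *)
have [mh | hm] := leqP m h.+1.
  have := C h.+2; rewrite (leq_sizeP _ _ sz) ?ltnS // eqxx orbT fps_coef0.
  by move/eqP; rewrite eq_sym oner_eq0.
have := e_le_coef (alternating h.+1) (down h.+1 _); rewrite ch hm !C eqxx orbT => /(_ isT).
by rewrite (_ : (_ || _) = false) ?ler10 //; lia.
Qed.

Lemma palindromicD n P Q : palindromic n P -> palindromic n Q -> palindromic n (P + Q).
Proof.
move=> [sP pP] [sQ pQ]; split=> [|j jn]; last by rewrite !coefD (pP j jn) (pQ j jn).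
by apply: leq_trans (size_polyD _ _) _; rewrite geq_max sP.
Qed.

Lemma palindromic_even_part h : palindromic h.*2.+2 (even_part h.*2.+2).
Proof.
rewrite even_partE; split=> [|j jn].
  apply/leq_sizeP => j jh; rewrite coefD !coef_shifted_qint.
  by do 2![case: ifP => [? |_]]; rewrite ?addr0 //; lia.
(* The reflection exchanges the degrees [h] and [h.+2]. *)
rewrite !coefD !coef_shifted_qint addrC.
by congr (_ + _); congr (if _ then _ else _); lia.
Qed.

Lemma elem_sym_part_nseq h k : elem_sym_part (nseq h k) = elem_sym k ^+ h.
Proof.
elim: h => [|h IH]; first by rewrite /elem_sym_part big_nil.
by rewrite [nseq _ _]/= elem_sym_part_cons IH exprS.
Qed.

Theorem theorem3p2 (n : nat) (n_ge2 : (2 <= n)%N) :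
  let X : {poly fps} := chromatic_qsym (cycle_edges n) in
  let Y : {poly fps} := X + elem_sym_part (nseq n./2 2%N) *: 'X^(n./2) in
  (odd n -> e_unimodal X /\ palindromic n X) /\
  (~~ odd n ->
     [/\ e_positive X, palindromic n X & ~ e_unimodal X] /\
     (e_unimodal Y /\ palindromic n Y)).
Proof.
move=> X Y; have [odd_n | even_n] := boolP (odd n); split=> // _.
  rewrite /X; case: n n_ge2 odd_n {X Y} => [|[|n]] // _ odd_n.
  have [Z pZ ->] := chromatic_cycle_decomposition n.
  rewrite /even_part odd_n addr0.
  by split; [exact: punimod_e_unimodal pZ | exact: punimod_palindromic pZ].
have [h nh] : exists h, n = h.*2.+2 by exists n./2.-1; lia.
rewrite {}/Y {}/X; subst n => {n_ge2 even_n}.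
have [Z pZ EX] := chromatic_cycle_decomposition h.*2.
have pY : punimod h.*2.+2 (chromatic_qsym (cycle_edges h.*2.+2)
   + elem_sym_part (nseq h.*2.+2./2 2%N) *: 'X^(h.*2.+2./2)).
  rewrite elem_sym_part_nseq /= doubleK EX -addrA; apply: punimodD => //.
  (* The added term fills the gap: t^h (1 + t^2) + t^(h+1) = t^h [3]. *)
  rewrite [W in punimod _ W](_ : _ = shifted_qint (elem_sym 2 ^+ h.+1) h 3).
    by apply: punimod_qint; [exact: epos_elem_symX | lia].
  rewrite even_partE /shifted_qint -mul_polyC !qintS qint0.
  rewrite -[h.+2]addn2 exprD; move: (_%:P) => e.
  by rewrite !exprS expr0; ring.
split; last by split; [exact: punimod_e_unimodal pY | exact: punimod_palindromic pY].
split; last exact: not_e_unimodal.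
- move=> j; apply: epos_e_le0; rewrite EX even_partE !coefD !coef_shifted_qint.
  apply: eposD; first exact: punimod_epos pZ.
  by apply: eposD; case: ifP => _; (exact: epos0 || exact: epos_elem_symX).
- rewrite EX; apply: palindromicD; first exact: punimod_palindromic.
  exact: palindromic_even_part.
Qed.
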